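(* For all $s,w\in\mathbb{N}$, there exists $\eta\in\mathbb{N}$ such that every graph with treewidth at most $w$ and containing no almost $(\leq 1)$-subdivision of $K_{s+1}$ is $s$-choosable with clustering $\eta$.
   Context: $\mathbb{N}=\{1,2,\dots\}$. Graphs are finite and may have loops and parallel edges. A graph $H'$ is an almost $(\leq 1)$-subdivision of a graph $H$ if $H'$ can be obtained from $H$ by subdividing edges, where at most one edge is subdivided more than once (so every other edge is replaced by a path with at most one internal vertex, and one edge may be replaced by a path of arbitrary length). A graph $G$ contains such a graph if some subgraph of $G$ is isomorphic to it. A color is an element of $\mathbb{Z}$. A coloring of $G$ is any function assigning one color to each vertex (adjacent vertices may receive the same color). A monochromatic component of a coloring is a connected component of the subgraph of $G$ induced by all vertices assigned some one color. A coloring has clustering $\eta$ if every monochromatic component has at most $\eta$ vertices. A list-assignment $L$ of $G$ assigns to each vertex $v$ a non-empty set $L(v)$ of colors; an $L$-coloring is a coloring $c$ with $c(v)\in L(v)$ for every vertex $v$. The graph $G$ is $\ell$-choosable with clustering $\eta$ if for every list-assignment $L$ with $|L(v)|\geq \ell$ for all $v\in V(G)$, there is an $L$-coloring of $G$ with clustering $\eta$. *)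

(* Defs.v *)
From HB Require Import structures.
From mathcomp Require Import all_boot all_order all_algebra.
From mathcomp Require Import all_classical.

Set Implicit Arguments.
Unset Strict Implicit.
Unset Printing Implicit Defensive.

(* Finite graphs with loops and parallel edges.  Edges are undirected: [src]
   and [tgt] merely name the two (possibly equal) ends of an edge, and every
   notion below is independent of which end is called [src]. *)
Record mgraph := MGraph {
  vert : finType;
  edge : finType;
  src : edge -> vert;
  tgt : edge -> vert
}.

Definition ends (G : mgraph) (e : edge G) : {set vert G} := [set src e; tgt e].

Definition adj (G : mgraph) : rel (vert G) :=
  [rel x y | [exists e : edge G, ends e == [set x; y]]].

Definition isomorphic (G H : mgraph) : Prop :=
  exists (f : vert G -> vert H) (g : edge G -> edge H),
    [/\ bijective f, bijective g & forall e, ends (g e) = f @: ends e].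

(* The vertices [f @: setT] and edges [g @: setT] form the subgraph of [G]
   that is isomorphic to [H]. *)
Definition has_subgraph_iso_to (G H : mgraph) : Prop :=
  exists (f : vert H -> vert G) (g : edge H -> edge G),
    [/\ injective f, injective g & forall e, ends (g e) = f @: ends e].

Definition complete_graph (n : nat) : mgraph :=
  @MGraph 'I_n {p : 'I_n * 'I_n | (p.1 < p.2)%N}
    (fun e => (val e).1) (fun e => (val e).2).

(* [subdivide k] replaces each edge [e] of [H] by a path with [k e] internal
   vertices.  The [j]-th vertex of that path, [0 <= j <= (k e).+1], is
   [subdiv_path k e j]; its [i]-th edge joins the vertices [i] and [i.+1]. *)
Section Subdivide.
Variables (H : mgraph) (k : edge H -> nat).

Definition subdiv_vert : finType := (vert H + {e : edge H & 'I_(k e)})%type.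
Definition subdiv_edge : finType := {e : edge H & 'I_(k e).+1}.

Definition subdiv_path (e : edge H) (j : nat) : subdiv_vert :=
  if j is j'.+1 then
    if insub j' is Some i then inr (Tagged (fun e' => 'I_(k e')) (i : 'I_(k e)))
    else inl (tgt e)
  else inl (src e).

Definition subdivide : mgraph :=
  @MGraph subdiv_vert subdiv_edge
    (fun ei => subdiv_path (tag ei) (tagged ei))
    (fun ei => subdiv_path (tag ei) (tagged ei).+1).

End Subdivide.

Definition almost_le1_subdivision (H' H : mgraph) : Prop :=
  exists k : edge H -> nat,
    (#|[set e | (1 < k e)%N]| <= 1)%N /\ isomorphic H' (subdivide k).

Definition contains_almost_le1_subdivision (G H : mgraph) : Prop :=
  exists H' : mgraph, almost_le1_subdivision H' H /\ has_subgraph_iso_to G H'.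

Definition induced_rel (T : finType) (e : rel T) (A : {set T}) : rel T :=
  [rel x y | [&& x \in A, y \in A & e x y]].

Definition connected_set (T : finType) (e : rel T) (A : {set T}) : Prop :=
  {in A &, forall x y, connect (induced_rel e A) x y}.

(* A duplicate-free closed walk of length 2 just goes back and forth along one
   edge; the cycles of a simple graph are those of length at least 3. *)
Definition is_tree (T : finType) (e : rel T) : Prop :=
  [/\ symmetric e, irreflexive e, (0 < #|T|)%N, connected_set e [set: T]
    & forall p : seq T, ucycle e p -> (size p <= 2)%N].

Definition tree_decomposition (G : mgraph) (T : finType) (e : rel T)
    (bag : T -> {set vert G}) : Prop :=
  [/\ is_tree e,
      forall v : vert G, exists t : T, v \in bag t,
      forall f : edge G, exists t : T, ends f \subset bag t
    & forall v : vert G, connected_set e [set t | v \in bag t]].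

(* The predecessor is truncated; this matters only if every bag is empty, i.e.
   if [G] has no vertex. *)
Definition width (G : mgraph) (T : finType) (bag : T -> {set vert G}) : nat :=
  (\max_(t : T) #|bag t|).-1.

Definition treewidth_at_most (G : mgraph) (w : nat) : Prop :=
  exists (T : finType) (e : rel T) (bag : T -> {set vert G}),
    tree_decomposition e bag /\ (width bag <= w)%N.

Definition monochromatic_component (G : mgraph) (c : vert G -> int)
    (v : vert G) : {set vert G} :=
  [set u | connect (induced_rel (@adj G) [set x | c x == c v]) v u].

Definition has_clustering (G : mgraph) (c : vert G -> int) (eta : nat) : Prop :=
  forall v : vert G, (#|monochromatic_component c v| <= eta)%N.

Definition list_assignment (G : mgraph) (L : vert G -> set int) : Prop :=
  forall v : vert G, (L v !=set0)%classic.

Definition choosable_with_clustering (G : mgraph) (l eta : nat) : Prop :=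
  forall L : vert G -> set int, list_assignment L ->
    (forall v : vert G, (`I_l #<= L v)%card) ->
    exists c : vert G -> int,
      (forall v : vert G, L v (c v)) /\ has_clustering c eta.

(* Main.v *)
Require Import Defs.
From HB Require Import structures.
From mathcomp Require Import all_boot all_order all_algebra.
From mathcomp Require Import all_classical.
From mathcomp Require Import fintype finset zify.

(* The colouring is built around a precoloured set [Y] of bounded size, removing
   from the lists the colours of neighbours in [Y].  If [Y] is large, bounded
   treewidth yields a small balanced separator; it is coloured too and the two
   sides are treated separately, a quadratic bound on the size of the components
   meeting [Y] being stable under this recursion.  If [Y] is small, its
   colour classes are closed off one after the other: to close off colour [a],
   the outside vertices with at least [s - 1] neighbours in [Y] receive colours
   other than [a], all others having lost [a] already if they touch it.

   There are boundedly many such vertices, apart from some that can be cut off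
   beforehand.  Indeed, if [s - 1] vertices [S] have many common neighbours and
   two of these were joined by a path avoiding [S], then a shortest such path,
   together with paths of length two between the vertices of [S], would form an
   almost (<= 1)-subdivision of the complete graph on [s + 1] vertices.  So each
   component of [G - S] contains at most one common neighbour [v] of [S]; if it
   misses [Y], then, once [v] avoids the colours of [S], every vertex of the
   component does, and the component can be coloured on its own. *)

Set Implicit Arguments.
Unset Strict Implicit.
Unset Printing Implicit Defensive.

Local Open Scope nat_scope.

(** * Walks and cardinalities in finite types *)

Lemma connect_closed (T : finType) (r : rel T) (R : {set T}) (x y : T) :
  (forall a b, r a b -> a \in R -> b \in R) ->
  connect r x y -> x \in R -> y \in R.
Proof.
move=> Rr /connectP[p]; elim: p x => [|z p IHp] x /= => [_ -> //|].
by case/andP=> /Rr xz /IHp IHz /IHz + /xz; apply.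
Qed.

Lemma connect_piece (T : finType) (r r' : rel T) (K : {set T}) (x y : T) :
  (forall a b, r a b -> a \in K -> b \in K /\ r' a b) ->
  connect r x y -> x \in K -> connect r' x y.
Proof.
move=> rK /connectP[p]; elim: p x => [|z p IHp] x /= => [_ -> //|].
case/andP=> xz /IHp IHz /IHz{}IHz /(rK _ _ xz)[zK xz'].
exact: connect_trans (connect1 xz') (IHz zK).
Qed.

Lemma exists_subset_card (T : finType) (A : {set T}) (n : nat) :
  n <= #|A| -> exists2 B : {set T}, B \subset A & #|B| = n.
Proof.
move=> nA; have : 0 < #|[set B : {set T} | B \subset A & #|B| == n]|.
  by rewrite cards_draws bin_gt0.
by case/card_gt0P=> B; rewrite inE => /andP[BA /eqP]; exists B.
Qed.

Lemma leq_card_bigcup (I T : finType) (P : pred I) (F : I -> {set T}) (m : nat) :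
  (forall i, P i -> #|F i| <= m) -> #|\bigcup_(i | P i) F i| <= #|P| * m.
Proof.
move=> Fm; rewrite -sum_nat_const.
have: #|\bigcup_(i | P i) F i| <= \sum_(i | P i) #|F i|.
  elim/big_rec2: _ => [|i A k _ Ak]; first by rewrite cards0.
  exact: leq_trans (leq_card_setU _ _).1 (leq_add _ _).
by move/leq_trans; apply; apply: leq_sum.
Qed.

(** * Lists and components after a partial colouring *)

Section Colouring.

Variables (V C : finType) (e : rel V) (s : nat).
Hypothesis e_sym : symmetric e.

Implicit Types (K U Y Z S : {set V}) (c phi : V -> C) (L : V -> {set C}).

Definition nbrs Y v := [set y in Y | e v y].

Definition mono U phi := induced_rel [rel x y | e x y && (phi x == phi y)] U.

Definition component U phi v := [set x | connect (mono U phi) v x].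

Definition reach U phi Z := [set x | [exists z in Z, connect (mono U phi) z x]].

(* [L v] holds the colours still available to [v] once [Y] has been coloured by
   [c]: the colours of its neighbours in [Y] are removed from it as long as there
   are at most [s - 2] of them. *)
Definition admissible U Y c L := forall v, v \in U -> v \notin Y ->
  [/\ 1 < #|L v|, s <= #|L v :\: c @: nbrs Y v| + #|nbrs Y v|
    & #|nbrs Y v|.+1 < s -> [disjoint L v & c @: nbrs Y v]].

(** A vertex with at least [s - 1] neighbours in [Y] keeps its list, since the count in [admissible]
    would no longer guarantee two colours after a removal. *)
Definition update Y c L v :=
  if #|nbrs Y v|.+1 < s then L v :\: c @: nbrs Y v else L v.

Lemma update_sub Y c L v : update Y c L v \subset L v.
Proof. by rewrite /update; case: ifP => // _; exact: subsetDl. Qed.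

Lemma monoE U phi x y :
  mono U phi x y = [&& x \in U, y \in U, e x y & phi x == phi y].
Proof. by []. Qed.

Lemma mono_sym U phi : symmetric (mono U phi).
Proof.
move=> x y; rewrite !monoE e_sym [phi x == _]eq_sym.
by case: (x \in U) (y \in U) => [] [].
Qed.

Lemma reach_step U phi Z x y :
  mono U phi x y -> x \in reach U phi Z -> y \in reach U phi Z.
Proof.
move=> xy; rewrite !inE => /exists_inP[z zZ zx]; apply/exists_inP; exists z => //.
exact: connect_trans zx (connect1 xy).
Qed.

Lemma sub_reach U phi Z : Z \subset reach U phi Z.
Proof. by apply/subsetP=> z zZ; rewrite inE; apply/exists_inP; exists z. Qed.

Lemma reach_subW U phi Z K : Z \subset K ->
  (forall a b, mono U phi a b -> a \in K -> b \in K) -> reach U phi Z \subset K.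
Proof.
move=> /subsetP ZK Kr; apply/subsetP=> x; rewrite inE => /exists_inP[z zZ zx].
exact: connect_closed Kr zx (ZK _ zZ).
Qed.

(** A monochromatic walk that starts in [K] stays there, where both colourings agree. This carries
    component bounds over from a colouring of one part to the combined colouring. *)
Lemma component_piece U U' phi phi' K v :
  {in K, phi =1 phi'} -> K \subset U' ->
  (forall a b, mono U phi a b -> a \in K -> b \in K) ->
  v \in K -> component U phi v \subset component U' phi' v.
Proof.
move=> eq_phi /subsetP KU' Kr vK; apply/subsetP=> x; rewrite !inE => vx.
apply: (connect_piece (K := K) _ vx vK) => a b ab aK.
have bK := Kr _ _ ab aK; split=> //.
by rewrite monoE !KU' // -!eq_phi //; case/and3P: ab.
Qed.

Lemma reach_piece U U' phi phi' K Z :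
  {in K, phi =1 phi'} -> K \subset U' ->
  (forall a b, mono U phi a b -> a \in K -> b \in K) ->
  Z \subset K -> reach U phi Z \subset reach U' phi' Z.
Proof.
move=> eq_phi KU' Kr /subsetP ZK; apply/subsetP=> x.
rewrite !inE => /exists_inP[z zZ zx]; apply/exists_inP; exists z => //.
have := component_piece eq_phi KU' Kr (ZK _ zZ).
by move/subsetP/(_ x); rewrite !inE; apply.
Qed.

Lemma nbrsS Y Y' v : Y \subset Y' -> nbrs Y v \subset nbrs Y' v.
Proof. by move=> /subsetP YY'; apply/subsetP=> y; rewrite !inE => /andP[/YY'->]. Qed.

Lemma admissible_sub U U' Y Y' c L : admissible U Y c L ->
  (forall v, v \in U' -> v \notin Y' -> [/\ v \in U, v \notin Y & nbrs Y' v = nbrs Y v]) ->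
  admissible U' Y' c L.
Proof. by move=> adm sub v vU vY; have [? ? ->] := sub v vU vY; apply: adm. Qed.

(** Each newly coloured neighbour removes at most one more colour and adds one to the number of
    coloured neighbours, so the sum in [admissible] stays at least [s]. With at most [s - 2]
    coloured neighbours, this leaves at least two colours. *)
Lemma admissible_update U Y Y' c c' L : Y \subset Y' -> {in Y, c' =1 c} ->
  admissible U Y c L -> admissible U Y' c' (update Y' c' L).
Proof.
move=> YY' cc' adm v vU vY'.
have vY : v \notin Y by apply: contra vY'; apply: (subsetP YY').
have [L2 Ls _] := adm v vU vY.
have NN' := nbrsS v YY'.
have Leq : update Y' c' L v :\: c' @: nbrs Y' v = L v :\: c' @: nbrs Y' v.
  by rewrite /update; case: ifP => // _; rewrite setDDl setUid.
have cN : c' @: nbrs Y v = c @: nbrs Y v.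
  by apply: eq_in_imset => y; rewrite inE => /andP[/cc'].
have cD : c' @: nbrs Y' v \subset c @: nbrs Y v :|: c' @: (nbrs Y' v :\: nbrs Y v).
  by rewrite -cN -imsetU setDE setUIr setUCr setIT; apply/imsetS/subsetUr.
have Ls' : s <= #|L v :\: c' @: nbrs Y' v| + #|nbrs Y' v|.
  pose M := c' @: (nbrs Y' v :\: nbrs Y v).
  have := subset_leq_card (setDS (L v) cD); rewrite -setDDl -/M.
  have := cardsD (L v :\: c @: nbrs Y v) M.
  have := subset_leq_card (subsetIr (L v :\: c @: nbrs Y v) M).
  have : #|M| <= #|nbrs Y' v| - #|nbrs Y v|.
    have <- : #|nbrs Y' v :\: nbrs Y v| = #|nbrs Y' v| - #|nbrs Y v|.
      by rewrite cardsD (setIidPr NN').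
    exact: leq_imset_card.
  have := subset_leq_card NN'.
  lia.
split; rewrite ?Leq //; rewrite /update; case: ifP => //.
- by move=> N's; move: Ls' N's; clear; lia.
- by rewrite disjoint_sym disjoints_subset setCD => _ _; apply: subsetUr.
Qed.

(** * Cutting off pendant branches *)

Variable eta : nat.

Definition colouring_of U Y c L phi :=
  [/\ {in Y, phi =1 c}, forall v, v \in U -> v \notin Y -> phi v \in L v
    & forall v, v \in U -> #|component U phi v| <= eta].

Definition common_nbrs S := [set v in ~: S | [forall z in S, e v z]].

Definition branch U S v := [set x | connect (induced_rel e (U :\: S)) v x].

(* A branch of [U - S] that misses [Y] and whose only common neighbour of [S] is
   [v] can be cut off and coloured on its own, once [v] avoids the colours of [S]. *)
Definition pendant U Y S v :=
  [&& S \subset Y, #|S|.+1 == s, v \in U :\: Y, [forall z in S, e v z],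
      [disjoint branch U S v & Y]
    & [forall u in branch U S v, [forall z in S, e u z] ==> (u == v)]].

Lemma branch_sub U S v : v \in U :\: S -> branch U S v \subset U :\: S.
Proof.
move=> vUS; apply/subsetP=> x; rewrite inE => vx.
by apply: connect_closed vx vUS => a b /and3P[].
Qed.

Lemma branch_step U S v a b : v \in U :\: S ->
  a \in branch U S v -> b \in U -> e a b -> b \in branch U S v :|: S.
Proof.
move=> vUS aB bU ab; rewrite inE; case: (boolP (b \in S)) => bS; rewrite ?orbT // orbF.
have aUS := subsetP (branch_sub vUS) _ aB.
move: aB; rewrite !inE => va; apply: connect_trans va (connect1 _).
by apply/and3P; split=> //; rewrite inE bS.
Qed.

(** The [s - 1] vertices of [S] leave [v] a colour [d] that none of them has. Any other vertex of
    the branch is not adjacent to all of [S], so its list already avoids the colours of its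
    neighbours in [S]. Hence no monochromatic edge leaves the branch within [U], and its colouring
    combines freely with [phi1]. *)
Lemma split_pendant U Y c L S v phi1 :
  1 < s -> Y \subset U -> admissible U Y c L -> pendant U Y S v ->
  (forall c' L', let U' := branch U S v :|: S in let Y' := v |: S in
     Y' \subset U' -> #|Y'| <= s -> #|U'| + #|U' :\: Y'| < #|U| + #|U :\: Y| ->
     admissible U' Y' c' L' -> exists phi, colouring_of U' Y' c' L' phi) ->
  colouring_of (U :\: branch U S v) Y c L phi1 ->
  exists phi, colouring_of U Y c L phi /\
    forall Z, Z \subset Y ->
      reach U phi Z \subset reach (U :\: branch U S v) phi1 Z.
Proof.
move=> s1 YU adm /and5P[SY /eqP Ss vUY /forall_inP vS /andP[BY /forall_inP Bv]] IH.
have [vU vY] : v \in U /\ v \notin Y by move: vUY; rewrite inE => /andP[].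
have vS' : v \notin S by apply: contra vY; apply: (subsetP SY).
have vUS : v \in U :\: S by rewrite inE vS'.
have vB : v \in branch U S v by rewrite inE.
have BUS := branch_sub vUS.
have BU : branch U S v \subset U by apply: subset_trans BUS (subsetDl _ _).
have Bstep a b : a \in branch U S v -> b \in U -> e a b -> b \in branch U S v :|: S.
  exact: branch_step.
have nBY x : x \in branch U S v -> x \notin Y.
  by move=> xB; rewrite (disjointFr BY).
have nBS x : x \in branch U S v -> x \notin S.
  by move=> xB; apply: contra (nBY _ xB); apply: (subsetP SY).
move: (branch U S v) => B in IH Bv BY vB BUS BU Bstep nBY nBS *.
case=> phi1c phi1L phi1eta.
have nbB x : x \in B -> nbrs Y x = nbrs S x.
  move=> xB; apply/setP=> y; rewrite !inE; apply: andb_id2r => xy.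
  apply/idP/idP=> [yY|/(subsetP SY)//].
  have := Bstep _ _ xB (subsetP YU _ yY) xy.
  by rewrite inE (disjointFl BY yY).
have nbv : nbrs S v = S.
  by apply/setP=> z; rewrite inE; apply: andb_idr => /vS.
have [d dL dS] : exists2 d, d \in L v & d \notin c @: S.
  have [_ + _] := adm v vU vY; rewrite nbB // nbv => dS.
  have /card_gt0P[d] : 0 < #|L v :\: c @: S| by rewrite -(ltn_add2r #|S|) add0n Ss.
  by rewrite inE => /andP[dS' dL]; exists d.
pose c2 x := if x == v then d else c x.
have c2S : {in S, c2 =1 c}.
  by move=> z zS; rewrite /c2; case: eqP vS' zS => // -> /negbTE->.
have [phi2 [phi2c phi2L phi2eta]] :
    exists phi, colouring_of (B :|: S) (v |: S) c2 (update (v |: S) c2 L) phi.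
  apply: IH.
  - by rewrite subUset sub1set inE vB subsetUr.
  - by rewrite cardsU1 vS' -Ss.
  - have -> : (B :|: S) :\: (v |: S) = B :\ v.
      apply/setP=> x; rewrite !inE; case: (boolP (x \in S)) => xS.
        by rewrite orbT /=; apply/esym/negbTE/nandP; right; apply: contraL xS => /nBS.
      by rewrite !orbF.
    (* Since [B] lies in [U :\: Y] and [S] in [Y], neither summand of the measure grows; moving [v]
       into the precoloured set makes the second one smaller. *)
    have lt_mu a b x b1 u y : a <= b + x -> b = true + b1 -> b <= u - y ->
        y <= u -> x <= y -> a + b1 < u + (u - y) by clear; lia.
    have cUY : #|U :\: Y| = #|U| - #|Y| by rewrite cardsD (setIidPr YU).
    rewrite cUY; apply: (lt_mu _ #|B| #|S|); rewrite ?subset_leq_card //.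
    + by rewrite leq_card_setU.
    + by rewrite (cardsD1 v B) vB.
    + rewrite -cUY; apply: subset_leq_card; apply/subsetP=> x xB.
      by rewrite inE nBY ?(subsetP BU).
  - apply: admissible_update (subsetUr _ _) c2S _.
    apply: admissible_sub adm _ => x; rewrite inE => /orP[xB xS|->//].
    by rewrite nBY ?nbB ?(subsetP BU).
exists (fun x => if x \in B then phi2 x else phi1 x).
have phi2S x : x \in S -> phi2 x = c x.
  by move=> xS; rewrite phi2c ?c2S // inE xS orbT.
have phi2B x : x \in B -> phi2 x \in L x.
  move=> xB; case: (eqVneq x v) => [->|xv].
    by rewrite phi2c ?inE ?eqxx // /c2 eqxx.
  apply: (subsetP (update_sub (v |: S) c2 _ _)); apply: phi2L; first by rewrite inE xB.
  by rewrite !inE negb_or xv nBS.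
have sepB a b : a \in B -> b \in S -> e a b -> phi2 a != c b.
  move=> aB bS ab; case: (eqVneq a v) => [->|av].
    rewrite phi2c ?inE ?eqxx // /c2 eqxx.
    by apply: contra dS => /eqP->; apply: imset_f.
  have [_ _ ]:= adm a (subsetP BU _ aB) (nBY _ aB); rewrite nbB // => dis.
  have {}dis : [disjoint L a & c @: nbrs S a].
    apply: dis; rewrite -Ss ltnS; apply: proper_card; rewrite properE.
    apply/andP; split; first by apply/subsetP=> z; rewrite inE => /andP[].
    apply: contra av => /subsetP Sa.
    have := Bv a aB; move/implyP; apply; apply/forall_inP=> z /Sa.
    by rewrite inE => /andP[].
  apply: contraL (phi2B _ aB) => /eqP->; rewrite (disjointFl dis) //.
  by apply: imset_f; rewrite inE bS.
set phi := fun x => _.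
have monoB a b : mono U phi a b -> (a \in B) = (b \in B).
  have half x y : mono U phi x y -> x \in B -> y \in B.
    rewrite monoE => /and4P[xU yU xy]; rewrite /phi => + xB; rewrite xB.
    have := Bstep _ _ xB yU xy; rewrite inE => /orP[//|yS].
    case: (boolP (y \in B)) => // yB; rewrite phi1c ?(subsetP SY) //.
    by rewrite (negbTE (sepB _ _ xB yS xy)).
  by move=> ab; apply/idP/idP; apply: half; rewrite // mono_sym.
have phiB : {in B, phi =1 phi2} by move=> x xB; rewrite /phi xB.
have phiU : {in U :\: B, phi =1 phi1}.
  by move=> x; rewrite inE /phi => /andP[/negbTE->].
have monoU a b : mono U phi a b -> a \in U :\: B -> b \in U :\: B.
  by move=> ab; rewrite !inE (monoB _ _ ab); case/and4P: ab => _ -> _ _ /andP[->].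
have YUB : Y \subset U :\: B.
  apply/subsetP=> y yY; rewrite inE (subsetP YU) // andbT.
  by apply: contraL yY => /nBY.
split; last first.
  by move=> Z ZY; apply: reach_piece phiU _ monoU _ => //; apply: subset_trans YUB.
split=> [y yY|x xU xY|x xU].
- by rewrite phiU ?phi1c ?(subsetP YUB).
- by rewrite /phi; case: ifP => xB; rewrite ?phi2B // phi1L // inE xB.
case: (boolP (x \in B)) => xB.
  have xBS : x \in B :|: S by rewrite inE xB.
  apply: leq_trans (phi2eta x xBS); apply: subset_leq_card.
  by apply: component_piece phiB _ _ xB; rewrite ?subsetUl // => a b /monoB->.
have xUB : x \in U :\: B by rewrite inE xB.
apply: leq_trans (phi1eta x xUB); apply: subset_leq_card.
exact: component_piece phiU _ monoU xUB.
Qed.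

(** * Crowded vertices and closing off colours *)

Variable t : nat.
Hypothesis s1 : 1 < s.
Hypothesis sparse : forall S x y, #|S|.+1 = s -> t < #|common_nbrs S| ->
  x \in common_nbrs S -> y \in common_nbrs S ->
  connect (induced_rel e (~: S)) x y -> x = y.

Lemma branch_connect U S v x :
  x \in branch U S v -> connect (induced_rel e (~: S)) v x.
Proof.
rewrite inE; apply: connect_sub => a b /and3P[aU bU ab]; apply: connect1.
by apply/and3P; move: aU bU; rewrite !inE => /andP[-> _] /andP[-> _].
Qed.

(** Each crowded vertex is a common neighbour of one of at most [2 ^ #|Y|] sets [S] of [s - 1]
    vertices of [Y]. If [S] has more than [t] common neighbours, [sparse] puts them into distinct
    components outside [S]. The branch of one in [U :\: Y] meets [Y], as it would be pendant
    otherwise, so there are at most [#|Y|] of those. *)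
Lemma card_crowded U Y : Y \subset U -> (forall S v, ~~ pendant U Y S v) ->
  #|[set v in U :\: Y | s <= #|nbrs Y v|.+1]| <= 2 ^ #|Y| * (t + #|Y|).
Proof.
move=> YU nopend.
have s_gt0 : 0 < s by exact: ltnW.
pose P : pred {set V} := [pred S : {set V} | (S \subset Y) && (#|S|.+1 == s)].
have crowdedP : [set v in U :\: Y | s <= #|nbrs Y v|.+1] \subset
    \bigcup_(S | P S) (common_nbrs S :&: (U :\: Y)).
  apply/subsetP=> v; rewrite inE => /andP[vUY sv].
  have /exists_subset_card[S SN Ss] : s.-1 <= #|nbrs Y v| by rewrite -ltnS prednK.
  have SY : S \subset Y.
    by apply: subset_trans SN _; apply/subsetP=> y; rewrite inE => /andP[].
  apply/bigcupP; exists S; first by apply/andP; rewrite SY Ss prednK.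
  rewrite in_setI vUY andbT inE in_setC; move: vUY; rewrite inE => /andP[vY vU].
  apply/andP; split; first by apply: contra vY; apply: (subsetP SY).
  by apply/forall_inP=> z /(subsetP SN); rewrite inE => /andP[].
apply: leq_trans (subset_leq_card crowdedP) _.
apply: (@leq_trans (#|P| * (t + #|Y|))); last first.
  rewrite leq_mul2r -card_powerset; apply/orP; right; apply: subset_leq_card.
  by apply/subsetP=> S; rewrite !inE => /andP[].
apply: leq_card_bigcup => S /andP[SY /eqP Ss].
case: (leqP #|common_nbrs S| t) => [cS|tS].
  by rewrite (leq_trans (subset_leq_card (subsetIl _ _))) // (leq_trans cS) ?leq_addr.
apply: leq_trans (leq_addl _ _).
pose rep v := odflt v [pick y in Y | y \in branch U S v].
have repP v : v \in common_nbrs S :&: (U :\: Y) ->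
    rep v \in Y /\ rep v \in branch U S v.
  rewrite inE => /andP[vC vUY]; rewrite /rep; case: pickP => [y /andP[]//|noY].
  have vUS : v \in U :\: S.
    by move: vC vUY; rewrite !inE => /andP[-> _] /andP[_ ->].
  case/negP: (nopend S v); rewrite /pendant SY Ss eqxx vUY /=.
  move: (vC); rewrite inE => /andP[_ ->] /=; apply/andP; split.
    by rewrite disjoint_sym; apply/pred0P=> y /=; rewrite noY.
  apply/forall_inP=> u uB; apply/implyP=> uS; rewrite eq_sym; apply/eqP.
  apply: (sparse Ss tS vC _ (branch_connect uB)).
  rewrite inE uS andbT inE; have := subsetP (branch_sub vUS) _ uB.
  by rewrite inE => /andP[].
rewrite -(card_in_imset (f := rep)) => [|v u vC uC eq_rep]; last first.
  have [_ vr] := repP v vC; have [_ ur] := repP u uC.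
  move: vC uC; rewrite inE => /andP[vC _]; rewrite inE => /andP[uC _].
  apply: (sparse Ss tS vC uC); apply: connect_trans (branch_connect vr) _.
  rewrite eq_rep sym_connect_sym ?(branch_connect ur) // => a b.
  by rewrite /induced_rel /= e_sym andbCA.
by apply: subset_leq_card; apply/subsetP=> _ /imsetP[v /repP[? _] ->].
Qed.

(* The size of [Y] after its crowded vertices, those outside [Y] with at least
   [s - 1] neighbours in [Y], have been added to it. *)
Definition crowd_bound n := n + 2 ^ n * (t + n).

Lemma leq_iter_crowd_bound j b : b <= iter j crowd_bound b.
Proof.
elim: j => //= j IHj; apply: leq_trans IHj _; exact: leq_addr.
Qed.

(* [K] is closed when no monochromatic edge can ever leave it, however the
   colouring [c] of [Y] is extended from the lists [L]. *)
Definition closed_off U Y c L K := forall x v, x \in K -> v \in U -> v \notin K ->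
  e x v -> if v \in Y then c v != c x else c x \notin L v.

Lemma closed_off_reach U Y c L K phi Z : colouring_of U Y c L phi ->
  K \subset Y -> closed_off U Y c L K -> Z \subset K -> reach U phi Z \subset K.
Proof.
move=> [phic phiL _] KY Kcl ZK; apply: reach_subW => // a b.
rewrite monoE => /and4P[aU bU ab] phiab aK; case: (boolP (b \in K)) => // bK.
have := Kcl a b aK bU bK ab; rewrite -(phic a (subsetP KY _ aK)) (eqP phiab).
by case: ifP => [bY|/negbT bY]; [rewrite phic ?eqxx | rewrite phiL].
Qed.

Lemma colouring_of_update U Y Y' c c' L phi :
  Y \subset Y' -> {in Y, c' =1 c} ->
  (forall v, v \in U -> v \in Y' -> v \notin Y -> c' v \in L v) ->
  colouring_of U Y' c' (update Y' c' L) phi -> colouring_of U Y c L phi.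
Proof.
move=> /subsetP YY' cc' c'L [phic phiL phieta]; split=> // [y yY|v vU vY].
  by rewrite phic ?cc' ?YY'.
case: (boolP (v \in Y')) => vY'; first by rewrite phic ?c'L.
by apply: (subsetP (update_sub Y' c' L v)); apply: phiL.
Qed.

Section CloseOff.

Variables (theta g mu : nat).
Hypotheses (s_theta : s <= theta) (g_theta : g <= theta).
Hypothesis IH : forall U Y c L, Y \subset U -> #|Y| <= theta ->
  #|U| + #|U :\: Y| < mu -> admissible U Y c L -> exists phi, colouring_of U Y c L phi.

(** Outer induction on the bound [j] on the number of colours still to be closed off, inner
    induction on [#|U|] for cutting off pendant branches. Each colour costs one application of
    [crowd_bound] to the bound [b] on [#|Y|]. When [F] is empty, [Z] lies in the closed set [K], so
    whatever it reaches stays in [K], hence in [Y]. *)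
Lemma close_off (j b : nat) U Y c L K Z (F : {set C}) :
  iter j crowd_bound b <= g -> Y \subset U -> #|Y| <= b ->
  #|U| + #|U :\: Y| < mu -> admissible U Y c L ->
  K \subset Y -> closed_off U Y c L K ->
  Z \subset Y -> (forall z, z \in Z -> (z \in K) || (c z \in F)) -> #|F| <= j ->
  exists phi, colouring_of U Y c L phi /\ #|reach U phi Z| <= g.
Proof.
elim: j b U Y c L K F => [|j IHj] b U Y c L K F jb YU Yb;
  have [n] := ubnP #|U|; elim: n U Y c L K YU Yb => // n IHn;
  move=> U Y c L K YU Yb Un muU adm KY Kcl ZY ZKF Fj.
- have F0 : F = set0 by apply/eqP; rewrite -cards_eq0 -leqn0.
  have ZK : Z \subset K by apply/subsetP=> z /ZKF; rewrite F0 inE orbF.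
  have Yg : #|Y| <= g by apply: leq_trans Yb jb.
  have [phi phiP] := IH YU (leq_trans Yg g_theta) muU adm.
  exists phi; split=> //; apply: leq_trans (subset_leq_card _) Yg.
  exact: subset_trans (closed_off_reach phiP KY Kcl ZK) KY.
have jb' : iter j crowd_bound b <= g.
  by apply: leq_trans jb; rewrite iterS leq_addr.
have [F0|[a aF]] := set_0Vmem F.
  apply: (IHj b U Y c L K F) => //; by rewrite F0 cards0.
case: (boolP [exists S, exists v, pendant U Y S v]) => [/existsP[S /existsP[v pv]]|nopend].
  have /and5P[SY _ vUY _ /andP[BY _]] := pv.
  have vU : v \in U by move: vUY; rewrite inE => /andP[].
  have [vY vB] : v \notin Y /\ v \in branch U S v by move: vUY; rewrite !inE => /andP[].
  have YUB : Y \subset U :\: branch U S v by rewrite subsetD YU disjoint_sym.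
  have ltU : #|U :\: branch U S v| < #|U|.
    apply: proper_card; rewrite properE subsetDl; apply/subsetPn; exists v => //.
    by rewrite inE vB.
  have [phi1 [phi1P phi1Z]] : exists phi,
      colouring_of (U :\: branch U S v) Y c L phi /\
      #|reach (U :\: branch U S v) phi Z| <= g.
    apply: (IHn _ Y c L K) => //.
    + by apply: leq_trans ltU _; rewrite -ltnS.
    + apply: leq_ltn_trans muU; apply: leq_add; apply: subset_leq_card.
        exact: subsetDl.
      by apply: setSD; apply: subsetDl.
    + by apply: admissible_sub adm _ => x; rewrite inE => /andP[_ ->] ->.
    + by move=> x u xK; rewrite inE => /andP[_]; apply: Kcl.
  have [phi [phiP phiZ]] : exists phi, colouring_of U Y c L phi /\
      forall Z, Z \subset Y -> reach U phi Z \subset reach (U :\: branch U S v) phi1 Z.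
    apply: (split_pendant s1 YU adm pv) phi1P => c' L' /= YU' Y's mu' adm'.
    apply: IH adm' => //; first exact: leq_trans Y's s_theta.
    exact: ltn_trans mu' muU.
  exists phi; split=> //; apply: leq_trans phi1Z; exact/subset_leq_card/phiZ.
have {}nopend S v : ~~ pendant U Y S v.
  by apply: contra nopend => pv; apply/existsP; exists S; apply/existsP; exists v.
set N := [set v in U :\: Y | s <= #|nbrs Y v|.+1].
(* Lists have at least two colours, so one other than [a] exists and the default [a] is never
   taken. *)
pose c' v := if v \in N then odflt a [pick d in L v :\ a] else c v.
have NUY v : v \in N -> v \in U /\ v \notin Y.
  by rewrite !inE => /andP[/andP[]].
have c'N v : v \in N -> c' v \in L v /\ c' v != a.
  move=> vN; rewrite /c' vN; case: pickP => [d|noL].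
    by rewrite !inE => /andP[->].
  have [vU vY] := NUY v vN; have [+ _ _] := adm v vU vY.
  have /eqP L0 : L v :\ a == set0 by apply/set0Pn=> -[d]; rewrite [_ \in _]noL.
  by have := cardsD1 a (L v); rewrite L0 cards0 addn0 => ->; case: (_ \in _).
have c'c : {in Y, c' =1 c}.
  by move=> y yY; rewrite /c'; case: ifP => // /NUY[_]; rewrite yY.
have YYN : Y \subset Y :|: N by exact: subsetUl.
have c'L v : v \in U -> v \in Y :|: N -> v \notin Y -> c' v \in L v.
  by rewrite in_setU => _ /orP[->//|/c'N[]].
(* The vertices of [N] avoid [a], so the class of [a] in the enlarged precoloured set is still its
   class in [Y]. *)
pose K' := K :|: [set x in Y | c x == a].
have [||||||||||phi [phiP phiZ]] := IHj (crowd_bound b) U (Y :|: N) c'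
    (update (Y :|: N) c' L) K' (F :\ a).
- by rewrite -iterSr.
- by rewrite subUset YU; apply/subsetP=> v /NUY[].
- apply: leq_trans (leq_card_setU _ _).1 _.
  have card_le : #|Y| + #|N| <= crowd_bound #|Y|.
    by rewrite leq_add2l; apply: card_crowded.
  apply: leq_trans card_le _; rewrite /crowd_bound.
  by apply: leq_add => //; apply: leq_mul; rewrite ?leq_add2l ?leq_pexp2l.
- apply: leq_ltn_trans muU; rewrite leq_add2l; apply: subset_leq_card.
  exact: setDS.
- exact: (admissible_update YYN c'c adm).
- apply: subset_trans YYN; rewrite subUset KY.
  by apply/subsetP=> x; rewrite inE => /andP[].
- move=> x v xK' vU; rewrite !in_setU !negb_or => /andP[vK va] xv.
  have xY : x \in Y.
    by move: xK'; rewrite inE => /orP[/(subsetP KY)//|]; rewrite inE => /andP[].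
  rewrite (c'c x xY); move: xK'; rewrite in_setU => /orP[xK|].
    have := Kcl x v xK vU vK xv; case: ifP => vY /=; first by rewrite c'c.
    move=> cxL; case: ifP => vN.
      by apply: contraNneq cxL => <-; have [] := c'N _ vN.
    by apply: contra cxL; apply: (subsetP (update_sub _ _ _ _)).
  rewrite inE => /andP[_ /eqP cxa]; rewrite cxa; case: ifP.
    move=> /orP[vY|/c'N[]//]; rewrite c'c //.
    by move: va; rewrite inE vY.
  move/negbT; rewrite negb_or => /andP[vY vN]; apply/negP.
  move/(subsetP (update_sub _ _ _ _)) => aL.
  have [_ _ dis] := adm v vU vY.
  have {}dis : [disjoint L v & c @: nbrs Y v].
    by apply: dis; move: vN; rewrite !inE vY vU -ltnNge.
  by move: aL; rewrite (disjointFl dis) // -cxa imset_f // inE xY e_sym.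
- exact: subset_trans ZY YYN.
- move=> z zZ; have zY := subsetP ZY _ zZ.
  rewrite in_setU inE zY c'c //= in_setD1; case: eqVneq => //= _; rewrite ?orbT //.
  by rewrite orbF; apply: ZKF.
- by move: Fj; rewrite (cardsD1 a F) aF.
exists phi; split=> //; exact: colouring_of_update phiP.
Qed.

End CloseOff.

(** * Gluing along separations, and the main recursion *)

Lemma glue U A B Y c L phiA phiB phi :
  U \subset A :|: B -> U :&: (A :&: B) \subset Y ->
  (forall x y, e x y -> (x \in A) && (y \in A) || (x \in B) && (y \in B)) ->
  colouring_of (U :&: A) (Y :&: A) c L phiA ->
  colouring_of (U :&: B) (Y :&: B) c L phiB ->
  Y \subset U ->
  {in U :&: A, phi =1 phiA} -> {in U :&: B, phi =1 phiB} ->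
  #|reach (U :&: A) phiA (Y :&: A) :|: reach (U :&: B) phiB (Y :&: B)| <= eta ->
  colouring_of U Y c L phi /\
  reach U phi Y \subset
    reach (U :&: A) phiA (Y :&: A) :|: reach (U :&: B) phiB (Y :&: B).
Proof.
move=> /subsetP UAB /subsetP UABY edge [Ac AL Aeta] [Bc BL Beta] YU phiA_eq phiB_eq.
set RA := reach _ phiA _; set RB := reach _ phiB _ => Reta.
have YR : Y \subset RA :|: RB.
  apply/subsetP=> y yY; have := UAB y (subsetP YU _ yY).
  rewrite !in_setU => /orP[yA|yB]; apply/orP; [left|right];
    by apply: (subsetP (sub_reach _ _ _)); rewrite inE yY.
have reach_in D phiD : reach (U :&: D) phiD (Y :&: D) \subset D.
  apply: reach_subW; first exact: subsetIr.
  by move=> a b; rewrite monoE => /and4P[_ +_ _ _]; rewrite inE => /andP[].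
(* If [a] is reached on the side of [D'], it lies on both sides, hence in [Y], and so belongs to the
   reach on the side of [D] as well; the monochromatic edge then continues there. *)
have step (D D' : {set V}) phiD phiD' a b : {in U :&: D, phi =1 phiD} ->
    (forall x, x \in U -> x \in D -> x \in D' -> x \in Y) ->
    a \in D -> b \in D -> mono U phi a b ->
    a \in reach (U :&: D) phiD (Y :&: D) :|: reach (U :&: D') phiD' (Y :&: D') ->
    b \in reach (U :&: D) phiD (Y :&: D).
  move=> phiD_eq DD' aD bD; rewrite monoE => /and4P[aU bU ab ?] aR.
  apply: (@reach_step _ _ _ a).
    by rewrite monoE !inE aU bU aD bD ab -!phiD_eq ?inE ?aU ?bU.
  move: aR; rewrite in_setU => /orP[//|aD'].
  have {}aD' := subsetP (reach_in _ _) _ aD'.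
  by apply: (subsetP (sub_reach _ _ _)); rewrite inE aD DD'.
have YAB x : x \in U -> x \in A -> x \in B -> x \in Y.
  by move=> xU xA xB; apply: UABY; rewrite !inE xU xA.
have YBA x : x \in U -> x \in B -> x \in A -> x \in Y.
  by move=> xU xB xA; apply: YAB.
have Rstep a b : mono U phi a b -> a \in RA :|: RB -> b \in RA :|: RB.
  move=> ab aR; have /and4P[_ _ eab _] := ab; rewrite inE.
  have /orP[/andP[aA bA]|/andP[aB bB]] := edge a b eab.
    by rewrite (step A B phiA phiB a).
  by rewrite (step B A phiB phiA a) ?orbT // setUC.
have Rreach : reach U phi Y \subset RA :|: RB by exact: reach_subW.
split=> //; split=> [y yY|v vU vY|v vU].
- have yU := subsetP YU _ yY; have := UAB y yU; rewrite inE => /orP[yA|yB].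
    by rewrite phiA_eq ?Ac // inE ?yU ?yY.
  by rewrite phiB_eq ?Bc // inE ?yU ?yY.
- have := UAB v vU; rewrite inE => /orP[vA|vB].
    by rewrite phiA_eq ?AL // inE ?vU ?(negbTE vY).
  by rewrite phiB_eq ?BL // inE ?vU ?(negbTE vY).
(* A component meeting [RA :|: RB] stays inside it. Any other one contains no vertex of [Y], so it
   cannot cross to the other side and lies in a component of [phiA] or of [phiB]. *)
case: (boolP (v \in RA :|: RB)) => vR.
  apply: leq_trans Reta; apply: subset_leq_card; apply/subsetP=> x.
  by rewrite inE => vx; apply: connect_closed Rstep vx vR.
have piece (D D' : {set V}) phiD : {in U :&: D, phi =1 phiD} -> v \in D ->
    (forall x, x \in U -> x \in D -> x \in D' -> x \in Y) ->
    (forall x y, e x y -> (x \in D) && (y \in D) || (x \in D') && (y \in D')) ->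
    component U phi v \subset component (U :&: D) phiD v.
  move=> phiD_eq vD DD' edgeD.
  apply: (@component_piece _ _ _ _ ((U :&: D) :\: (RA :|: RB))).
  - by move=> x; rewrite inE => /andP[_ /phiD_eq].
  - exact: subsetDl.
  - move=> a b ab; rewrite inE => /andP[aR aUD].
    rewrite inE; apply/andP; split.
      by apply: contra aR; apply: Rstep; rewrite mono_sym.
    move: aUD; rewrite inE => /andP[aU aD]; have /and4P[_ bU eab _] := ab.
    rewrite inE bU; have /orP[/andP[_ ->//]|/andP[aD' _]] := edgeD a b eab.
    by case/negP: aR; apply: (subsetP YR); apply: DD'.
  - by rewrite inE vR inE vU.
have := UAB v vU; rewrite inE => /orP[vA|vB].
  have vUA : v \in U :&: A by rewrite inE vU.
  exact: leq_trans (subset_leq_card (piece A B phiA phiA_eq vA YAB edge)) (Aeta v vUA).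
have vUB : v \in U :&: B by rewrite inE vU.
apply: leq_trans (Beta v vUB); apply: subset_leq_card.
by apply: (piece B A) => // x y /edge; rewrite orbC.
Qed.

(* The precoloured sets on the two sides of a separator of size [w] have sizes
   [a] and [b]; the constant [8] makes [n ^ 2] superadditive along such splits. *)
Lemma balanced_squares n w a b a1 b1 : 8 * w < n -> 3 * a1 <= 2 * n ->
  3 * b1 <= 2 * n -> a1 + b1 <= n -> a <= a1 + w -> b <= b1 + w ->
  a ^ 2 + b ^ 2 <= n ^ 2.
Proof.
rewrite -!mulnn => nw an bn abn /[dup] aw1 aw bw.
have {aw1}aa : a * a <= (a1 + w) * (a1 + w) by exact: leq_mul.
have bb : b * b <= (b1 + w) * (b1 + w) by exact: leq_mul.
have a1n : 3 * (a1 * a1) <= 2 * n * a1 by rewrite mulnA leq_mul2r an orbT.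
have b1n : 3 * (b1 * b1) <= 2 * n * b1 by rewrite mulnA leq_mul2r bn orbT.
have nab : n * (a1 + b1) <= n * n by rewrite leq_mul2l abn orbT.
have wab : w * (a1 + b1) <= w * n by rewrite leq_mul2l abn orbT.
have nn : 8 * w * n <= n * n by rewrite leq_mul2r (ltnW nw) orbT.
have ww : w * (8 * w) <= w * n by rewrite leq_mul2l (ltnW nw) orbT.
nia.
Qed.

Variables (W theta g : nat).
Hypothesis separator : forall Y, exists A B : {set V},
  [/\ A :|: B = [set: V], #|A :&: B| <= W,
      forall x y, e x y -> (x \in A) && (y \in A) || (x \in B) && (y \in B),
      3 * #|Y :&: (A :\: B)| <= 2 * #|Y| & 3 * #|Y :&: (B :\: A)| <= 2 * #|Y|].
Hypotheses (s_theta : s <= theta) (g_theta : g <= theta).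
Hypothesis g_large : iter (8 * W).+1 crowd_bound (8 * W).+1 <= g.
Hypothesis eta_large : g * theta ^ 2 <= eta.

(** Induction on [#|U| + #|U :\: Y|], which drops both when [U] shrinks and when more vertices are
    precoloured. *)
Lemma list_colouring U Y c L : Y \subset U -> #|Y| <= theta -> admissible U Y c L ->
  exists phi, colouring_of U Y c L phi /\ #|reach U phi Y| <= g * #|Y| ^ 2.
Proof.
have [n] := ubnP (#|U| + #|U :\: Y|).
elim: n U Y c L => // n IHn U Y c L mu YU Ytheta adm.
(* Extends [c] by arbitrary colours from the lists, for the vertices of a separator or for one extra
   vertex. *)
pose c' v := if v \in Y then c v else odflt (c v) [pick d in L v].
have c'c : {in Y, c' =1 c} by move=> y yY; rewrite /c' yY.
have c'L v : v \in U -> v \notin Y -> c' v \in L v.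
  move=> vU vY; rewrite /c' (negbTE vY); case: pickP => //= noL.
  have [+ _ _] := adm v vU vY; suff -> : #|L v| = 0 by [].
  by apply: eq_card0.
have gW : (8 * W).+1 <= g := leq_trans (leq_iter_crowd_bound _ _) g_large.
have g_gt0 : 0 < g by apply: leq_trans gW.
case: (leqP #|Y| (8 * W)) => YW; last first.
  have [A [B [AB ABW edge YA YB]]] := separator Y.
  pose Y' := Y :|: (U :&: (A :&: B)).
  have YY' : Y \subset Y' by exact: subsetUl.
  have Y'U : Y' \subset U by rewrite subUset YU subsetIl.
  have adm' := admissible_update YY' c'c adm.
  have cardY : #|Y :&: (A :\: B)| + #|Y :&: (B :\: A)| <= #|Y|.
    rewrite -cardsUI [X in _ + X](_ : _ = 0) ?addn0.
      by apply: subset_leq_card; rewrite subUset !subsetIl.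
    apply: eq_card0 => x; rewrite !inE.
    by case: (x \in A) (x \in B) => [] []; rewrite ?andbF.
  have cardY2 : #|Y| <= #|Y :&: (A :\: B)| + #|Y :&: (B :\: A)| + W.
    apply: leq_trans (leq_add (leq_card_setU _ _).1 ABW).
    apply: leq_trans (leq_card_setU _ _).1; apply: subset_leq_card.
    apply/subsetP=> y yY; have : y \in A :|: B by rewrite AB inE.
    by rewrite !inE yY; case: (y \in A) (y \in B) => [] [].
  have side (D D' : {set V}) : D :|: D' = [set: V] ->
      (forall x y, e x y -> (x \in D) && (y \in D) || (x \in D') && (y \in D')) ->
      A :&: B = D :&: D' -> 3 * #|Y :&: (D :\: D')| <= 2 * #|Y| ->
      0 < #|Y :&: (D' :\: D)| ->
      #|Y' :&: D| <= #|Y :&: (D :\: D')| + W /\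
      exists phi, colouring_of (U :&: D) (Y' :&: D) c' (update Y' c' L) phi /\
        #|reach (U :&: D) phi (Y' :&: D)| <= g * #|Y' :&: D| ^ 2.
    move=> DD' edgeD ABD YD /card_gt0P[x]; rewrite !inE => /and3P[xY xD xD'].
    have Y'D : #|Y' :&: D| <= #|Y :&: (D :\: D')| + W.
      apply: leq_trans (leq_add (leqnn _) ABW).
      apply: leq_trans (leq_card_setU _ _).1; apply: subset_leq_card.
      rewrite /Y' ABD; apply/subsetP=> y; rewrite !inE.
      by case: (y \in Y) (y \in D) (y \in D') => [] [] []; rewrite ?andbF.
    split=> //; apply: IHn.
    + rewrite -ltnS; apply: leq_trans mu; rewrite ltnS -addSn; apply: leq_add.
        apply: proper_card; rewrite properE subsetIl; apply/subsetPn; exists x.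
          exact: (subsetP YU).
        by rewrite inE (negbTE xD) andbF.
      apply: subset_leq_card; apply/subsetP=> y; rewrite !inE.
      by case: (y \in Y) (y \in U) (y \in D) => [] [] [].
    + exact: setSI.
    + apply: leq_trans Y'D _; apply: leq_trans Ytheta.
      by move: YD YW; clear; lia.
    + apply: admissible_sub adm' _ => v; rewrite inE => /andP[vU vD].
      rewrite inE vD andbT => vY'; split=> //; apply/setP=> y.
      rewrite [LHS]inE [RHS]inE inE; apply: andb_id2r => vy.
      apply: andb_idr => yY'; have /orP[/andP[]//|/andP[vD' _]] := edgeD v y vy.
      by case/negP: vY'; rewrite inE ABD !inE vU vD vD' orbT.
  (* Each strict side holds at most two thirds of [Y] and the separator has fewer than [#|Y| / 8]
     vertices, so the other strict side meets [Y]. Hence both recursive calls lose a vertex of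
     [U]. *)
  have YBA_gt0 : 0 < #|Y :&: (B :\: A)| by move: cardY2 YA YW; clear; lia.
  have YAB_gt0 : 0 < #|Y :&: (A :\: B)| by move: cardY2 YB YW; clear; lia.
  have [Y'A [phiA [phiAP phiAR]]] := side A B AB edge erefl YA YBA_gt0.
  have BA : B :|: A = [set: V] by rewrite setUC.
  have edgeBA x y : e x y -> (x \in B) && (y \in B) || (x \in A) && (y \in A).
    by move=> /edge; rewrite orbC.
  have [Y'B [phiB [phiBP phiBR]]] := side B A BA edgeBA (setIC A B) YB YAB_gt0.
  have squares := balanced_squares YW YA YB cardY Y'A Y'B.
  set RA := reach _ phiA _ in phiAR; set RB := reach _ phiB _ in phiBR.
  have cardR : #|RA :|: RB| <= g * #|Y| ^ 2.
    apply: leq_trans (leq_card_setU _ _).1 _; apply: leq_trans (leq_add phiAR phiBR) _.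
    by rewrite -mulnDr leq_mul2l squares orbT.
  have cardR_eta : #|RA :|: RB| <= eta.
    apply: leq_trans cardR _; apply: leq_trans eta_large.
    by rewrite leq_mul2l leq_sqr Ytheta orbT.
  pose phi v := if v \in A then phiA v else phiB v.
  have phiAE : {in U :&: A, phi =1 phiA} by move=> x; rewrite inE /phi => /andP[_ ->].
  have phiBE : {in U :&: B, phi =1 phiB}.
    move=> x; rewrite inE /phi => /andP[xU xB]; case: ifP => // xA.
    have [Ac _ _] := phiAP; have [Bc _ _] := phiBP.
    by rewrite Ac ?Bc // !inE xU xA xB orbT.
  have UAB : U \subset A :|: B by rewrite AB subsetT.
  have [phiP Rsub] := glue UAB (subsetUr _ _) edge phiAP phiBP Y'U phiAE phiBE cardR_eta.
  exists phi; split; first exact: colouring_of_update YY' c'c (fun v vU _ => c'L v vU) phiP.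
  apply: leq_trans cardR; apply: subset_leq_card; apply: subset_trans Rsub.
  apply: reach_subW => [|a b]; first exact: subset_trans YY' (sub_reach _ _ _).
  exact: reach_step.
(* The factor [#|Y| ^ 2] is at least 1 for nonempty [Y]; from an empty one nothing is reached. *)
suff [phi [phiP phiR]] : exists phi, colouring_of U Y c L phi /\ #|reach U phi Y| <= g.
  exists phi; split=> //; have [Y0|[y yY]] := set_0Vmem Y.
    rewrite (_ : reach U phi Y = set0) ?cards0 //; apply/setP=> x; rewrite !inE.
    by apply/negbTE/exists_inP=> -[z]; rewrite Y0 inE.
  have Y_gt0 : 0 < #|Y| by apply/card_gt0P; exists y.
  by apply: leq_trans phiR _; rewrite leq_pmulr // expn_gt0 Y_gt0.
have Yg : #|Y| <= g by apply: leq_trans YW _; apply: leq_trans gW.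
have [UY|[x xUY]] := set_0Vmem (U :\: Y).
  have {UY}UY : U = Y by apply/eqP; rewrite eqEsubset YU andbT -setD_eq0 UY.
  have stay a b : mono U c a b -> a \in U -> b \in U by rewrite monoE => /and4P[].
  exists c; split; last first.
    by apply: leq_trans Yg; apply: subset_leq_card; rewrite -{2}UY; apply: reach_subW.
  split=> // [v vU|v vU]; first by rewrite -UY vU.
  apply: leq_trans eta_large; apply: (@leq_trans #|U|).
    apply: subset_leq_card; apply/subsetP=> y; rewrite inE => vy.
    exact: connect_closed stay vy vU.
  rewrite UY; apply: leq_trans Yg _; rewrite leq_pmulr // expn_gt0.
  by rewrite (leq_trans _ s_theta) // ltnW.
(* One more precoloured vertex lowers the measure, so that the induction hypothesis applies inside
   [close_off] even without further progress. It makes [(8 * W).+1] the initial bound on the size of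
   the precoloured set. *)
have [xU xY] : x \in U /\ x \notin Y by move: xUY; rewrite inE => /andP[].
have YxY : Y \subset x |: Y by exact: subsetUr.
have ltx : #|U :\: (x |: Y)| < #|U :\: Y|.
  apply: proper_card; rewrite properE setDS //=; apply/subsetPn; exists x => //.
  by rewrite !inE eqxx.
have [|||||||||||phi [phiP phiR]] := @close_off theta g n s_theta g_theta _
    (8 * W).+1 (8 * W).+1 U (x |: Y) c' (update (x |: Y) c' L) set0 Y (c' @: Y).
- move=> U' Y' c0 L0 Y'U' Y't mu' adm0.
  by have [phi []] := IHn U' Y' c0 L0 mu' Y'U' Y't adm0; exists phi.
- exact: g_large.
- by rewrite subUset sub1set xU.
- by rewrite cardsU1 xY.
- by rewrite -ltnS; apply: leq_trans mu; rewrite ltnS ltn_add2l.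
- exact: admissible_update YxY c'c adm.
- exact: sub0set.
- by move=> y v; rewrite inE.
- exact: YxY.
- by move=> z zY; rewrite imset_f ?orbT.
- by rewrite (leq_trans (leq_imset_card _ _)) // ltnW.
exists phi; split=> //.
exact: colouring_of_update YxY c'c (fun v vU _ => c'L v vU) phiP.
Qed.

End Colouring.

(** * Balanced separations from tree decompositions *)

Lemma induced_rel_sym (T : finType) (r : rel T) (A : {set T}) :
  symmetric r -> connect_sym (induced_rel r A).
Proof.
move=> r_sym; apply: sym_connect_sym => a b.
by rewrite /induced_rel /= r_sym andbCA.
Qed.

Section TreeDecomposition.

Variables (V T : finType) (e : rel V) (r : rel T) (bag : T -> {set V}) (W : nat).
Hypothesis tree : is_tree r.
Hypothesis bag_cover : forall v, exists t, v \in bag t.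
Hypothesis bag_edge : forall x y, e x y -> exists t, (x \in bag t) && (y \in bag t).
Hypothesis bag_connected : forall v, connected_set r [set t | v \in bag t].
Hypothesis bag_card : forall t, #|bag t| <= W.

Implicit Types (t : T) (X : {set T}) (Y : {set V}).

Definition limb t (x : T) := [set y | connect (induced_rel r [set~ t]) x y].

(** As [r] is symmetric, such an [X] is a union of components of the tree without [t]. *)
Definition limb_closed t X :=
  t \notin X /\ forall a b, r a b -> a \in X -> b != t -> b \in X.

Definition hanging t X := [set v in ~: bag t | [exists x in X, v \in bag x]].

Lemma limb_closed_limb t (x : T) : x != t -> limb_closed t (limb t x).
Proof.
move=> xt; have sub : limb t x \subset [set~ t].
  apply/subsetP=> y; rewrite inE => xy.
  by apply: connect_closed xy _ => [a b /and3P[]//|]; rewrite !inE.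
split; first by apply/negP=> /(subsetP sub); rewrite !inE eqxx.
move=> a b ab aX bt; have at_ := subsetP sub _ aX.
move: aX; rewrite !inE => /connect_trans; apply; apply: connect1.
by apply/and3P; split; rewrite // !inE.
Qed.

(** The nodes whose bags contain [v] are connected and miss [t], so they cannot leave [X]. *)
Lemma hanging_bag t X v a : limb_closed t X -> v \in hanging t X ->
  v \in bag a -> a \in X.
Proof.
move=> [_ Xcl]; rewrite !inE => /andP[vt /exists_inP[x xX vx]] va.
have := @bag_connected v; move/(_ x a); rewrite !inE => /(_ vx va) xa.
apply: connect_closed xa xX => b d /and3P[_ + bd bX]; rewrite inE => vd.
by apply: Xcl bd bX _; apply: contraNneq vt => <-.
Qed.

Lemma hanging_separates t X : limb_closed t X ->
  let A := bag t :|: hanging t X in let B := ~: hanging t X in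
  [/\ A :|: B = [set: V], #|A :&: B| <= W &
      forall x y, e x y -> (x \in A) && (y \in A) || (x \in B) && (y \in B)].
Proof.
move=> Xcl A B; split.
- by rewrite /A /B -setUA setUCr setUT.
- apply: leq_trans (bag_card t); apply: subset_leq_card; apply/subsetP=> v.
  by rewrite in_setI in_setC in_setU => /andP[/orP[//|->]].
move=> x y /bag_edge[a /andP[xa ya]].
have inA v : v \in bag a -> a \in X -> v \in A.
  move=> va aX; rewrite in_setU inE in_setC; case: (v \in bag t) => //=.
  by apply/exists_inP; exists a.
have inB v : v \in bag a -> a \notin X -> v \in B.
  by move=> va; rewrite in_setC; apply: contra => vX; apply: hanging_bag Xcl vX va.
case: (boolP (a \in X)) => aX; apply/orP; [left | right].
  by rewrite !inA.
by rewrite !inB.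
Qed.

(** Neither walk uses the edge between [t] and [t'], as each avoids one of its ends. Together they
    would join [t'] to [t] without that edge, which would then close a cycle. *)
Lemma tree_edge_cut t t' b : r t t' ->
  connect (induced_rel r [set~ t']) b t ->
  connect (induced_rel r [set~ t]) b t' -> False.
Proof.
have [r_sym r_irr _ _ r_acyclic] := tree.
move=> tt' bt bt'.
have neq_tt' : t' != t by apply: contraTneq tt' => ->; rewrite r_irr.
pose r' := [rel x y | r x y && ([set x; y] != [set t; t'])].
have cut u : u \in [set t; t'] -> subrel (induced_rel r [set~ u]) r'.
  move=> uT x y; rewrite /induced_rel /r' /= !inE => /and3P[xu yu ->] /=.
  apply: contraTneq uT => /setP/(_ u); rewrite !inE => <-.
  by rewrite ![u == _]eq_sym (negbTE xu) (negbTE yu).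
have r't : connect r' t' t.
  apply: (@connect_trans _ _ b).
    rewrite (induced_rel_sym _ r_sym) in bt'.
    apply: (connect_sub _ bt') => x y xy; apply: connect1; apply: cut xy.
    by rewrite !inE eqxx.
  apply: (connect_sub _ bt) => x y xy; apply: connect1; apply: cut xy.
  by rewrite !inE eqxx orbT.
case/connectP: r't => p0 p0r; case/shortenP: p0r => p pr up _ lastp.
have : ucycle r (t' :: p).
  rewrite /ucycle up andbT /cycle rcons_path -lastp tt' andbT.
  by apply: sub_path pr => x y /andP[].
move/r_acyclic; case: p pr up lastp => [|x [|//]] /=.
  by move=> _ _ tt; rewrite tt eqxx in neq_tt'.
by move=> pr _ tx; move: pr; rewrite -tx /r' /= setUC eqxx andbF.
Qed.

Lemma hangingU t X X' : hanging t (X :|: X') = hanging t X :|: hanging t X'.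
Proof.
apply/setP=> v; rewrite !inE; case: (v \in bag t) => //=.
apply/exists_inP/orP=> [[x]|[]/exists_inP[x xX vx]].
- by rewrite inE => /orP[] xX vx; [left|right]; apply/exists_inP; exists x.
- by exists x; rewrite // inE xX.
- by exists x; rewrite // inE xX orbT.
Qed.

(** If no union of limbs at a node splits [Y] well, every node has a limb carrying more than two
    thirds of [Y]. Take such a limb, at a node [t], with fewest nodes, and let [t'] be a neighbour
    of [t] in it. A heavy limb at [t'] shares a vertex of [Y] with the first one, and by
    [tree_edge_cut] it does not contain [t]; so it lies strictly inside the first limb, against the
    choice. *)
Lemma balanced_separation Y : exists A B : {set V},
  [/\ A :|: B = [set: V], #|A :&: B| <= W,
      forall x y, e x y -> (x \in A) && (y \in A) || (x \in B) && (y \in B),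
      3 * #|Y :&: (A :\: B)| <= 2 * #|Y| & 3 * #|Y :&: (B :\: A)| <= 2 * #|Y|].
Proof.
have [r_sym r_irr T_gt0 r_conn _] := tree.
pose wt t X := #|Y :&: hanging t X|.
pose rest t X := #|Y :\: (bag t :|: hanging t X)|.
have [[t [X [Xcl Xle restle]]]|unbal] := EM (exists t X,
    [/\ limb_closed t X, 3 * wt t X <= 2 * #|Y| & 3 * rest t X <= 2 * #|Y|]).
  have [AB ABW edge] := hanging_separates Xcl.
  do 2![eexists]; split; [exact: AB | exact: ABW | exact: edge | |].
    apply: leq_trans Xle; rewrite leq_mul2l; apply/orP; right.
    apply: subset_leq_card; apply: setIS; apply/subsetP=> v.
    by rewrite in_setD in_setC negbK => /andP[].
  apply: leq_trans restle; rewrite leq_mul2l; apply/orP; right.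
  apply: subset_leq_card; apply/subsetP=> v.
  by rewrite in_setI in_setD => /and3P[? ? ?]; apply/setDP.
have disj t X : wt t X + rest t X <= #|Y|.
  rewrite -(cardsID (hanging t X) Y) leq_add2l; apply: subset_leq_card.
  by apply: setDS; apply: subsetUr.
have heavy t : exists x, (x != t) && (2 * #|Y| < 3 * wt t (limb t x)).
  case: (boolP [exists x, (x != t) && (2 * #|Y| < 3 * wt t (limb t x))]) => [/existsP//|].
  move=> /existsPn light; exfalso; apply: unbal; exists t.
  pose P X := [&& t \notin X,
      [forall a, [forall b, r a b ==> (a \in X) ==> (b != t) ==> (b \in X)]]
    & 3 * wt t X <= 2 * #|Y|].
  have PP X : reflect (limb_closed t X /\ 3 * wt t X <= 2 * #|Y|) (P X).
    apply: (iffP and3P) => [[tX /forallP Xcl le]|[[tX Xcl] le]].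
      split=> //; split=> // a b ab aX bt; have /forallP/(_ b) := Xcl a.
      by rewrite ab aX bt.
    split=> //; apply/forallP=> a; apply/forallP=> b.
    by apply/implyP=> ab; apply/implyP=> aX; apply/implyP; apply: Xcl ab aX.
  have P0 : P set0.
    apply/PP; split; first by split=> [|a b]; rewrite inE.
    rewrite /wt (_ : hanging t set0 = set0) ?setI0 ?cards0 //.
    by apply/setP=> v; rewrite !inE; apply/andP=> -[_ /exists_inP[x]]; rewrite inE.
  have [X /PP[Xcl Xle] Xmax] := arg_maxnP (fun X : {set T} => #|X|) P0.
  case: (leqP (3 * rest t X) (2 * #|Y|)) => [restle|restgt]; first by exists X.
  have /card_gt0P[y] : 0 < rest t X by lia.
  rewrite 2!inE negb_or => /andP[/andP[yt yX] yY].
  have [x yx] := bag_cover y.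
  have xt : x != t by apply: contraNneq yt => <-.
  have xX : x \notin X.
    apply: contra yX => xX; rewrite !inE yt /=; apply/exists_inP.
    by exists x.
  have xL : x \in limb t x by rewrite inE.
  have Lcl := limb_closed_limb xt.
  (* As the rest of [X] is heavy, [X] has less than a third of [Y]; a limb taking it beyond two
     thirds has more than a third, so it is balanced by itself. *)
  exists (limb t x); have := light x; rewrite xt /= -leqNgt => Lle; split=> //.
  have : 2 * #|Y| < 3 * wt t (X :|: limb t x).
    rewrite ltnNge; apply/negP=> XLle.
    have /Xmax : P (X :|: limb t x).
      apply/PP; split=> //; case: Xcl Lcl => [tX Xcl] [tL Lcl].
      split=> [|a b ab]; first by rewrite inE negb_or tX.
      rewrite !in_setU => /orP[aX|aL] bt; first by rewrite (Xcl a).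
      by rewrite (Lcl a) ?orbT.
    apply/negP; rewrite -ltnNge; apply: proper_card; rewrite properE subsetUl.
    by apply/subsetPn; exists x; rewrite // inE xL orbT.
  have : wt t (X :|: limb t x) <= wt t X + wt t (limb t x).
    by rewrite /wt hangingU setIUr leq_card_setU.
  by move: (disj t X) (disj t (limb t x)) restgt; clear; lia.
have [t0] : exists t0 : T, t0 \in [set: T] by apply/card_gt0P; rewrite cardsT.
have [x0 hx0] := heavy t0 => _.
have [[t x] /= /andP[xt hx] tmin] := @arg_minnP _ (t0, x0)
  (fun p => (p.2 != p.1) && (2 * #|Y| < 3 * wt p.1 (limb p.1 p.2)))
  (fun p => #|limb p.1 p.2|) hx0.
have Lcl := limb_closed_limb xt; have [tL Lstep] := Lcl.
have [t' t'L t't] : exists2 t', t' \in limb t x & r t' t.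
  apply/exists_inP; apply: contraNT tL => /exists_inPn noedge.
  have xTt := r_conn x t (in_setT x) (in_setT t).
  apply: (connect_closed _ xTt) => [a b /and3P[_ _ ab] aL|]; last by rewrite inE.
  by apply: (Lstep a) => //; apply: contraNneq (noedge a aL) => <-.
have [x' /andP[x't' hx']] := heavy t'.
have L'cl := limb_closed_limb x't'.
have [v] : exists v, v \in hanging t (limb t x) :&: hanging t' (limb t' x').
  apply/card_gt0P; move: hx hx'; rewrite /wt.
  have := subset_leq_card (subsetIl Y (hanging t (limb t x) :|: hanging t' (limb t' x'))).
  have := cardsUI (Y :&: hanging t (limb t x)) (Y :&: hanging t' (limb t' x')).
  rewrite -setIUr -setIIr.
  have := subset_leq_card (subsetIr Y (hanging t (limb t x) :&: hanging t' (limb t' x'))).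
  clear; lia.
rewrite in_setI => /andP[vL vL'].
have [b vb] := bag_cover v.
have bL := hanging_bag Lcl vL vb; have bL' := hanging_bag L'cl vL' vb.
have toL z : z \in limb t x -> connect (induced_rel r [set~ t]) b z.
  rewrite inE => xz; move: bL; rewrite inE (induced_rel_sym _ r_sym) => bx.
  exact: connect_trans bx xz.
case: (boolP (t \in limb t' x')) => tL'.
  exfalso; apply: (@tree_edge_cut t t' b); [by rewrite r_sym | | exact: toL].
  move: bL' tL'; rewrite !inE (induced_rel_sym _ r_sym) => bx' x't.
  exact: connect_trans bx' x't.
have : #|limb t' x'| < #|limb t x|.
  apply: proper_card; rewrite properE; apply/andP; split; last first.
    by apply/subsetPn; exists t' => //; case: L'cl.
  apply/subsetP=> y yL'.
  have : connect (induced_rel r [set~ t']) b y.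
    move: bL' yL'; rewrite !inE (induced_rel_sym _ r_sym).
    exact: connect_trans.
  move=> by_; have bI : b \in limb t x :&: limb t' x' by rewrite inE bL.
  suff : y \in limb t x :&: limb t' x' by rewrite in_setI => /andP[].
  apply: (connect_closed _ by_ bI) => a d /and3P[_ dt' ad].
  rewrite !in_setI => /andP[aL aL'].
  have dL' : d \in limb t' x'.
    by case: L'cl => _ step; apply: step ad aL' _; move: dt'; rewrite !inE.
  by rewrite dL' andbT; apply: Lstep ad aL _; apply: contraNneq tL' => <-.
by rewrite ltnNge; have := tmin (t', x') => /= -> //; rewrite x't'.
Qed.

End TreeDecomposition.

(** * Subdivisions of complete graphs *)

Section SubdivideSimple.

Variables (H : mgraph) (k : edge H -> nat).
Hypothesis loopless : forall e : edge H, src e != tgt e.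
Hypothesis ends_inj : injective (@ends H).

Lemma subdiv_path_inner (e : edge H) (j : nat) (jk : j < k e) :
  subdiv_path k e j.+1 = inr (Tagged (fun e' => 'I_(k e')) (Ordinal jk)).
Proof. by rewrite /subdiv_path insubT. Qed.

Lemma subdiv_path_last (e : edge H) : subdiv_path k e (k e).+1 = inl (tgt e).
Proof. by rewrite /subdiv_path insubF ?ltnn. Qed.

Lemma subdiv_path_tag (e : edge H) (j : nat) w :
  subdiv_path k e j = inr w -> tag w = e.
Proof. by case: j => //= j; case: insubP => //= u _ _ [<-]. Qed.

Lemma subdiv_path_inj (e : edge H) :
  {in [pred j | j <= (k e).+1] &, injective (subdiv_path k e)}.
Proof.
have cases j : j <= (k e).+1 ->
    [\/ j = 0, (exists2 i, j = i.+1 & i < k e) | j = (k e).+1].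
  case: j => [|j]; first by constructor 1.
  rewrite ltnS leq_eqVlt => /orP[/eqP->|jk]; first by constructor 3.
  by constructor 2; exists j.
have st := loopless e.
move=> i j /cases ci /cases cj.
case: ci => [->|[a -> ak]|->]; case: cj => [->|[b -> bk]|->] //;
  rewrite ?subdiv_path_last ?subdiv_path_inner //=.
- by move=> [es]; rewrite es eqxx in st.
- by case=> ->.
- by move=> [es]; rewrite es eqxx in st.
Qed.

Lemma subdivide_endsE (u : edge (subdivide k)) :
  ends u = [set subdiv_path k (tag u) (tagged u); subdiv_path k (tag u) (tagged u).+1].
Proof. by []. Qed.

(** This lets the edge map of an embedding be chosen edge by edge: its injectivity follows from that
    of the vertex map. An edge on a path with inner vertices has one of them as an end, which
    records the edge of [H]; the other edges keep their ends, and [H] is simple. *)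
Lemma subdivide_ends_inj : injective (@ends (subdivide k)).
Proof.
have inner (u : edge (subdivide k)) :
    0 < k (tag u) -> exists w, inr w \in ends u /\ tag w = tag u.
  move=> k0; rewrite subdivide_endsE.
  case: (tagged u) => -[|i] ik.
    exists (Tagged (fun e => 'I_(k e)) (Ordinal k0)); split=> //.
    by rewrite (subdiv_path_inner k0) !inE eqxx orbT.
  exists (Tagged (fun e => 'I_(k e)) (Ordinal (ik : i < k (tag u)))); split=> //.
  by rewrite (subdiv_path_inner (ik : i < k (tag u))) !inE eqxx.
have inner_tag (u : edge (subdivide k)) w : inr w \in ends u -> tag w = tag u.
  by rewrite subdivide_endsE !inE => /orP[] /eqP/esym/subdiv_path_tag.
have outer (u : edge (subdivide k)) : k (tag u) = 0 ->
    ends u = [set inl (src (tag u)); inl (tgt (tag u))].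
  move=> k0; rewrite subdivide_endsE.
  have -> : nat_of_ord (tagged u) = 0 by apply/eqP; rewrite -leqn0 -k0 -ltnS.
  by rewrite -(subdiv_path_last (tag u)) k0.
have tag_eq (u v : edge (subdivide k)) : ends u = ends v -> tag u = tag v.
  move=> uv; case: (posnP (k (tag u))) => [u0|/inner[w [wu <-]]]; last first.
    by apply: inner_tag; rewrite -uv.
  case: (posnP (k (tag v))) => [v0|/inner[w [wv <-]]]; last first.
    by apply/esym/inner_tag; rewrite uv.
  move: uv; rewrite !outer // => uv; apply: ends_inj; apply/setP=> z.
  by have /setP/(_ (inl z)) := uv; rewrite !inE.
move=> u v uv; have := tag_eq _ _ uv.
case: u v uv => e [i ik] [e' [j jk]] + /= ee'; subst e'.
rewrite !subdivide_endsE => /setP uv.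
suff ij : i = j by subst j; congr existT; apply: val_inj.
have inj a b : a < (k e).+2 -> b < (k e).+2 ->
  subdiv_path k e a = subdiv_path k e b -> a = b by move=> ak bk; apply: subdiv_path_inj.
have i2 : i < (k e).+2 by exact: leqW.
have j2 : j < (k e).+2 by exact: leqW.
have i3 : i.+1 < (k e).+2 by [].
have j3 : j.+1 < (k e).+2 by [].
have := uv (subdiv_path k e i); rewrite !inE eqxx => /esym/orP[] /eqP.
  by move/(inj _ _ i2 j2).
move=> /(inj _ _ i2 j3) ij.
have := uv (subdiv_path k e i.+1); rewrite !inE eqxx orbT => /esym/orP[] /eqP.
  by move=> /(inj _ _ i3 j2); rewrite ij; lia.
by move=> /(inj _ _ i3 j3)[].
Qed.

End SubdivideSimple.

Lemma complete_graph_loopless n (e : edge (complete_graph n)) : src e != tgt e.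
Proof. by case: e => -[i j] /= ij; rewrite -val_eqE /= neq_ltn ij. Qed.

Lemma complete_graph_ends_inj n : injective (@ends (complete_graph n)).
Proof.
move=> [[i j] /= ij] [[i' j'] /= ij']; rewrite /ends /= => /setP eq_ends.
apply: val_inj => /=.
have := eq_ends i; have := eq_ends j; have := eq_ends i'; rewrite !inE !eqxx ?orbT /=.
rewrite -!val_eqE /= => h1 h2 h3.
have [ii jj] : val i = val i' /\ val j = val j' by move: h1 h2 h3; simpl; lia.
by congr pair; apply: val_inj.
Qed.

(** A path with an interior vertex in [N] can be cut there to a shorter one between two vertices of
    [N]. Keeping the interior off [N] leaves the other vertices of [N] free as subdivision
    vertices. *)
Lemma shortest_link (T : finType) (r : rel T) (N : {set T}) (x y : T) :
  x \in N -> y \in N -> x != y -> connect r x y ->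
  exists x' y' q, [/\ x' \in N, y' \in N, path r x' (rcons q y'),
    uniq (x' :: rcons q y') & forall z, z \in q -> z \notin N].
Proof.
move=> xN yN xy /connectP[p pr py]; move: yN xy; rewrite {y}py.
have [m] := ubnP (size p); elim: m p x xN pr => // m IHm p0 x xN.
case/shortenP=> p pr up subp pm pN xp.
have {}pm : size p < m.+1.
  apply: leq_ltn_trans pm; apply: uniq_leq_size => //.
  by case/andP: up.
case/lastP: p pr up pm pN xp {subp} => [|q y] pr up pm.
  by rewrite eqxx.
rewrite last_rcons => yN xy.
case: (boolP (has (mem N) q)) => [/hasP[z zq zN]|/hasPn qN]; last first.
  by exists x, y, q; split.
case/splitPr: zq pr up pm => q1 q2; rewrite rcons_cat -cat_rcons cat_path => /andP[pr _].
move=> up pm; apply: (IHm (rcons q1 z) x) => //; rewrite ?last_rcons //.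
  by move: pm; rewrite !size_cat !size_rcons; lia.
by apply: contraTneq up => ->; rewrite /= mem_cat mem_rcons inE eqxx.
Qed.

Section Embedding.

Variables (G : mgraph) (n : nat) (S N : {set vert G}) (x y : vert G) (q : seq (vert G)).
Hypothesis card_S : #|S| = n.
Hypothesis adj_SN : forall u v, u \in S -> v \in N -> adj u v.
Hypothesis SN : forall v, v \in S -> v \notin N.
Hypotheses (xN : x \in N) (yN : y \in N).
Hypothesis path_q : path (@adj G) x (rcons q y).
Hypothesis uniq_q : uniq (x :: rcons q y).
Hypothesis q_outside : forall z, z \in q -> (z \notin S) && (z \notin N).
Hypothesis card_N : n * n + 1 < #|N|.

Local Notation K := (complete_graph n.+2).

Let lo (e : edge K) : nat := (val e).1.
Let hi (e : edge K) : nat := (val e).2.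

Let lohi e : lo e < hi e. Proof. by case: e. Qed.
Let hi_lt e : hi e < n.+2. Proof. exact: ltn_ord. Qed.

(* The branch vertices are those of [S], numbered below [n], then [x] and [y]:
   the edge from [n] to [n.+1] becomes the path [q]. *)
Let k (e : edge K) : nat := if hi e < n then 1 else if lo e == n then size q else 0.

Let branch_vertices : seq (vert G) := enum S ++ [:: x; y].
Let middles : seq (vert G) := enum (N :\ x :\ y).

(** Reading [lo] and [hi] as two digits in base [n] gives each edge inside [S] its own vertex of
    [N]. This takes [n * n] vertices besides [x] and [y], which [card_N] provides. *)
Let embed (z : subdiv_vert k) : vert G :=
  match z with
  | inl i => nth x branch_vertices i
  | inr u => if hi (tag u) < n then nth x middles (lo (tag u) * n + hi (tag u))
             else nth x q (tagged u)
  end.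

Let size_branch : size branch_vertices = n.+2.
Proof. by rewrite size_cat -cardE card_S addn2. Qed.

Let x_notin_S : x \notin S. Proof. by apply: contraL xN => /SN. Qed.
Let y_notin_S : y \notin S. Proof. by apply: contraL yN => /SN. Qed.

Let x_neq_y : x != y.
Proof. by move: uniq_q => /= /andP[]; rewrite mem_rcons inE negb_or => /andP[]. Qed.

Let uniq_branch : uniq branch_vertices.
Proof.
rewrite cat_uniq enum_uniq /= !mem_enum (negbTE x_notin_S) (negbTE y_notin_S) /=.
by rewrite inE x_neq_y.
Qed.

Let size_middles : n * n <= size middles.
Proof.
rewrite -cardE; have := cardsD1 x N; have := cardsD1 y (N :\ x).
by rewrite xN !inE yN eq_sym x_neq_y; move: card_N; clear; lia.
Qed.

Let middle_lt e : hi e < n -> lo e * n + hi e < size middles.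
Proof.
move=> en; apply: leq_trans size_middles; have := lohi e.
by move: en; clear; nia.
Qed.

Let middleP e : hi e < n ->
  nth x middles (lo e * n + hi e) \in N :\ x :\ y.
Proof. by move=> /middle_lt en; rewrite -mem_enum mem_nth. Qed.

Let lo_hi_inj e e' : lo e = lo e' -> hi e = hi e' -> e = e'.
Proof.
move=> l h; apply: val_inj; move: l h; rewrite /lo /hi.
case: (val e) (val e') => [a b] [a' b'] /=.
by move=> /val_inj-> /val_inj->.
Qed.

Let k_long e (i : 'I_(k e)) : hi e < n = false -> [/\ lo e = n, hi e = n.+1 & i < size q].
Proof.
case: i => i /=; rewrite /k => + en; rewrite en; case: eqP => // le ilt; split=> //.
by have := lohi e; have := hi_lt e; rewrite le; move: (hi e) => h; clear; lia.
Qed.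

Let branch_mem i : i < n.+2 ->
  (nth x branch_vertices i \in S) || (nth x branch_vertices i \in [:: x; y]).
Proof.
rewrite -size_branch => /(mem_nth x); rewrite mem_cat mem_enum.
by case/orP=> ->; rewrite ?orbT.
Qed.

Let inr_mem (u : {e : edge K & 'I_(k e)}) :
  if hi (tag u) < n then embed (inr u) \in N :\ x :\ y else embed (inr u) \in q.
Proof.
case: ifP => en /=; first by rewrite ifT //; apply: middleP.
by rewrite ifF //; have [_ _ ?] := k_long (tagged u) en; apply: mem_nth.
Qed.

Let branch_neq_inner i u : embed (inl i) != embed (inr u).
Proof.
apply/eqP=> eq_iu; have := branch_mem (ltn_ord i); have := inr_mem u.
rewrite -eq_iu /embed; case: ifP => _.
  rewrite !inE => /and3P[jy jx jN]; rewrite (negbTE jx) (negbTE jy) !orbF.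
  by move/SN; rewrite jN.
move=> iq; have /andP[iS iN] := q_outside iq; rewrite (negbTE iS) !inE /=.
by case/orP=> /eqP iE; rewrite iE ?xN ?yN in iN.
Qed.

Let embed_inj : injective embed.
Proof.
move=> [i|u] [j|v] eq_uv.
- congr inl; apply: val_inj; apply/eqP.
  by rewrite -(nth_uniq x _ _ uniq_branch) ?size_branch ?ltn_ord //; apply/eqP.
- by have := branch_neq_inner i v; rewrite eq_uv eqxx.
- by have := branch_neq_inner j u; rewrite eq_uv eqxx.
congr inr; have := inr_mem u; have := inr_mem v; rewrite -eq_uv.
have NqF z : z \in N :\ x :\ y -> z \in q -> False.
  by rewrite !inE => /and3P[_ _ zN] /q_outside; rewrite zN andbF.
move: eq_uv; rewrite /embed /=.
case: ifP => un; case: ifP => vn eq_uv zv zu.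
- have /eqP := eq_uv; rewrite nth_uniq ?middle_lt ?enum_uniq // => /eqP eqi.
  have n_gt0 : 0 < n by apply: leq_ltn_trans un.
  have h : hi (tag u) = hi (tag v).
    by have := congr1 (modn^~ n) eqi; rewrite !modnMDl !modn_small.
  have l : lo (tag u) = lo (tag v).
    by move/eqP: eqi; rewrite h eqn_add2r eqn_mul2r gtn_eqF //= => /eqP.
  have := lo_hi_inj l h; case: u v un vn {zu zv eq_uv eqi h l} => [e i] [e' j] /= en _ ee'.
  subst e'; congr existT; apply: val_inj; move: (ltn_ord i) (ltn_ord j).
  by rewrite {2 4}/k en /=; case: (val i) (val j) => [|?] [|?].
- by case: (NqF _ zu zv).
- by case: (NqF _ zv zu).
have [lu hu iu] := k_long (tagged u) un; have [lv hv iv] := k_long (tagged v) vn.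
have uq : uniq q by move: uniq_q; rewrite /= rcons_uniq => /and3P[].
have /eqP := eq_uv; rewrite nth_uniq // => /eqP ij.
have := @lo_hi_inj (tag u) (tag v); rewrite lu hu lv hv => /(_ erefl erefl).
case: u v ij {zu zv eq_uv un vn lu hu lv hv iu iv} => [e i] [e' j] /= ij ee'; subst e'.
by congr existT; apply: val_inj.
Qed.

Let branch_x : nth x branch_vertices n = x.
Proof. by rewrite nth_cat -cardE card_S ltnn subnn. Qed.

Let branch_y : nth x branch_vertices n.+1 = y.
Proof. by rewrite nth_cat -cardE card_S ltnNge leqnSn subSnn. Qed.

Let branch_S i : i < n -> nth x branch_vertices i \in S.
Proof.
move=> i_n; rewrite nth_cat -cardE card_S i_n -mem_enum mem_nth //.
by rewrite -cardE card_S.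
Qed.

Let adj_sym : symmetric (@adj G).
Proof. by move=> a b; rewrite /adj /= setUC. Qed.

Let embed_adj (u : subdiv_edge k) :
  adj (embed (subdiv_path k (tag u) (tagged u)))
      (embed (subdiv_path k (tag u) (tagged u).+1)).
Proof.
case: u => e [i ik].
change (adj (embed (subdiv_path k e i)) (embed (subdiv_path k e i.+1))).
have first : embed (subdiv_path k e 0) = nth x branch_vertices (lo e) by [].
have last : embed (subdiv_path k e (k e).+1) = nth x branch_vertices (hi e).
  by rewrite subdiv_path_last.
have inner j : j < k e -> embed (subdiv_path k e j.+1) =
    if hi e < n then nth x middles (lo e * n + hi e) else nth x q j.
  by move=> jk; rewrite (subdiv_path_inner jk).
case: (boolP (hi e < n)) => en.
  have k1 : k e = 1 by rewrite /k en.
  have := middleP en; rewrite !inE => /and3P[_ _ mN].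
  move: last (inner 0) ik; rewrite k1 en => last /(_ isT) inner0.
  case: i => [|[|i]] // _.
    by rewrite first inner0 adj_SN ?branch_S ?(ltn_trans (lohi e)).
  by rewrite last inner0 adj_sym adj_SN ?branch_S.
case: (eqVneq (lo e) n) => len.
  have kq : k e = size q by rewrite /k (negbTE en) len eqxx.
  have hE : hi e = n.+1.
    by have := lohi e; have := hi_lt e; rewrite len; move: (hi e) => h; clear; lia.
  have walk j : j <= (size q).+1 -> embed (subdiv_path k e j) = nth x (x :: rcons q y) j.
    case: j => [|j]; first by rewrite first len branch_x.
    rewrite ltnS leq_eqVlt => /orP[/eqP->|jq].
      by rewrite -{1}kq last hE branch_y /= nth_rcons ltnn eqxx.
    by rewrite inner ?kq // (negbTE en) /= nth_rcons jq.
  rewrite kq in ik; rewrite !walk //; last exact: ltnW.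
  by have /pathP := path_q; apply; rewrite size_rcons.
have k0 : k e = 0 by rewrite /k (negbTE en) (negbTE len).
move: last ik; rewrite k0; case: i => // last _; rewrite first last.
have lo_n : lo e < n.
  by move: len en (lohi e) (hi_lt e); move: (lo e) (hi e) => a b; clear; lia.
apply: adj_SN; first exact: branch_S.
have : (hi e == n) || (hi e == n.+1).
  by move: en (hi_lt e); move: (hi e) => b; clear; lia.
by case/orP=> /eqP->; rewrite ?branch_x ?branch_y.
Qed.

Lemma contains_of_link : contains_almost_le1_subdivision G K.
Proof.
exists (subdivide k); split.
  exists k; split.
    apply/card_le1_eqP => e e'; rewrite !inE => ke ke'.
    have long f : 1 < k f -> lo f = n /\ hi f = n.+1.
      move=> kf; have fn : hi f < n = false by move: kf; rewrite /k; case: ifP.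
      by have [] := k_long (Ordinal kf) fn.
    by have [? ?] := long e ke; have [? ?] := long e' ke'; apply: lo_hi_inj; congruence.
  exists id, id; split; [by exists id | by exists id | by move=> e; rewrite imset_id].
have /fin_all_exists[g gP] (u : edge (subdivide k)) :
    exists gu : edge G, ends gu = embed @: ends u.
  have /existsP[f /eqP fE] := embed_adj u; exists f.
  by rewrite fE subdivide_endsE imsetU !imset_set1.
exists embed, g; split=> // u v guv.
apply: (subdivide_ends_inj (@complete_graph_loopless _) (@complete_graph_ends_inj _)).
by apply: (imset_inj embed_inj); rewrite -!gP guv.
Qed.

End Embedding.

(** * Assembling the theorem *)

Lemma adj_sym (G : mgraph) : symmetric (@adj G).
Proof. by move=> a b; rewrite /adj /= setUC. Qed.

Lemma common_nbrs_separated (G : mgraph) (n : nat) (S : {set vert G}) (x y : vert G) :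
  ~ contains_almost_le1_subdivision G (complete_graph n.+2) ->
  #|S|.+1 = n.+1 -> n * n + 1 < #|common_nbrs (@adj G) S| ->
  x \in common_nbrs (@adj G) S -> y \in common_nbrs (@adj G) S ->
  connect (induced_rel (@adj G) (~: S)) x y -> x = y.
Proof.
move=> noK [cardS] cardN xN yN xy; apply/eqP/contraT => neq_xy; case: noK.
have [x' [y' [q [x'N y'N pq uq qN]]]] := shortest_link xN yN neq_xy xy.
apply: (contains_of_link cardS _ _ x'N y'N _ uq _ cardN).
- move=> u v uS; rewrite inE => /andP[_ /forall_inP vS].
  by rewrite adj_sym; apply: vS.
- by move=> v vS; rewrite !inE vS.
- by apply: sub_path pq => a b /and3P[].
- move=> z zq; rewrite qN // andbT.
  have /allP sub : all (mem (~: S)) (rcons q y').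
    elim: (rcons q y') x' pq {x'N uq} => //= a p IHp b /andP[/and3P[_ aS _] ab].
    by rewrite aS (IHp a).
  by have := sub z; rewrite mem_rcons inE zq orbT -in_setC; apply.
Qed.

Lemma treewidth_balanced_separation (G : mgraph) (w : nat) (Y : {set vert G}) :
  treewidth_at_most G w -> exists A B : {set vert G},
  [/\ A :|: B = [set: vert G], #|A :&: B| <= w.+1,
      forall x y, adj x y -> (x \in A) && (y \in A) || (x \in B) && (y \in B),
      3 * #|Y :&: (A :\: B)| <= 2 * #|Y| & 3 * #|Y :&: (B :\: A)| <= 2 * #|Y|].
Proof.
move=> [T [r [bag [[tree cover edges conn] width_w]]]].
apply: (balanced_separation tree cover _ conn) => [x y /existsP[f /eqP fE]|t].
  have [t] := edges f; rewrite fE => /subsetP sub; exists t.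
  by rewrite !sub // !inE eqxx ?orbT.
have : #|bag t| <= \max_(u : T) #|bag u| by exact: leq_bigmax.
by move: width_w; rewrite /width; lia.
Qed.

(** The lists may be infinite; choosing [s] colours from each yields a finite palette [C], on which
    colours can be counted. *)
Lemma finite_sublists (V : finType) (s : nat) (L : V -> set int) :
  (forall v, (`I_s #<= L v)%card) ->
  exists (C : finType) (col : C -> int) (F : V -> 'I_s -> C),
    [/\ injective col, forall v, injective (F v) & forall v i, L v (col (F v i))].
Proof.
move=> Ls.
have /fin_all_exists[f fP] v : exists f : nat -> int,
    (forall i, i < s -> L v (f i)) /\ {in [pred i | i < s] &, injective f}.
  have /card_leP[g0] := Ls v; pose g : {injfun `I_s >-> L v} := valLR 0%R g0.
  exists g; split=> [i i_s|i j i_s j_s]; first exact: (@funS _ _ _ _ g).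
  by apply: (@inj _ _ _ g); apply: mem_set.
pose cols := flatten [seq [seq f v i | i <- iota 0 s] | v <- enum V].
have fcols v (i : 'I_s) : f v i \in cols.
  apply/flatten_mapP; exists v; first by rewrite mem_enum.
  by apply: map_f; rewrite mem_iota add0n ltn_ord.
exists (seq_sub cols), (@ssval _ _), (fun v i => SeqSub (fcols v i)); split.
- exact: val_inj.
- by move=> v i j [ij]; apply/ord_inj/((fP v).2 i j _ _ ij); apply: ltn_ord.
- by move=> v i; apply: (fP v).1; apply: ltn_ord.
Qed.

Theorem theorem1 (s w : nat) (hs : (0 < s)%N) (hw : (0 < w)%N) :
  exists eta : nat, (0 < eta)%N /\
    forall G : mgraph,
      treewidth_at_most G w ->
      ~ contains_almost_le1_subdivision G (complete_graph s.+1) ->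
      choosable_with_clustering G s eta.
Proof.
case: s hs => // n _.
(* Beyond [t] common neighbours the embedding has enough vertices, and [m] bounds a small
   precoloured set with one extra vertex, for separators of size [w.+1]. [theta] admits both the
   sets of size at most [g] from [close_off] and those of size [s] from pendant branches; the
   summand [t] of the bound serves the case [s = 1]. *)
pose t := n * n + 1; pose m := (8 * w.+1).+1.
pose g := iter m (crowd_bound t) m; pose theta := g + n.+1.
exists (g * theta ^ 2 + t); split; first by rewrite /t; lia.
move=> G tw noK L _ Ls.
have [C [col [F [col_inj F_inj FL]]]] := finite_sublists Ls.
have sparse := @common_nbrs_separated G n _ _ _ noK.
have clustered (phi : vert G -> C) eta :
    (forall v, #|component (@adj G) setT phi v| <= eta) ->
    has_clustering (col \o phi) eta.
  move=> cl v; apply: leq_trans (cl v); apply: subset_leq_card.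
  apply/subsetP=> u; rewrite !inE; apply: connect_sub => a b.
  move=> /and3P[]; rewrite !inE /= => /eqP av /eqP bv ab; apply: connect1.
  by rewrite monoE !inE ab /=; apply/eqP/col_inj; rewrite av bv.
(* For [s = 1] every vertex is a common neighbour of the empty set, so either the graph has at most
   [t] vertices or no two distinct vertices are connected. *)
case: n => [|n] in t m g theta noK Ls F F_inj FL sparse *.
  exists (col \o fun v => F v ord0); split=> [v|]; first exact: FL.
  apply: clustered => v; apply: leq_trans (leq_addl _ _).
  case: (leqP #|vert G| t) => [|tV]; first by apply: leq_trans; apply: max_card.
  have cn0 x : x \in common_nbrs (@adj G) set0.
    by rewrite !inE /=; apply/forall_inP=> z; rewrite inE.
  have cnT : common_nbrs (@adj G) set0 = setT by apply/setP=> x; rewrite cn0 inE.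
  have one u : u \in component (@adj G) setT (fun v => F v ord0) v -> u = v.
    rewrite inE => vu; apply/esym; apply: (sparse set0) => //.
    - by rewrite cards0.
    - by rewrite cnT cardsT.
    - apply: (connect_sub _ vu) => a b; rewrite monoE => /and4P[_ _ ab _].
      by apply: connect1; apply/and3P; rewrite !inE.
  apply: (@leq_trans #|[set v]|); last by rewrite cards1.
  by apply: subset_leq_card; apply/subsetP=> u /one ->; rewrite inE.
pose lists v := [set F v i | i : 'I_n.+2].
have adm : admissible (@adj G) n.+2 setT set0 (fun v => F v ord0) lists.
  move=> v _ _; have -> : nbrs (@adj G) set0 v = set0.
    by apply/setP=> y; rewrite !inE.
  rewrite imset0 setD0 cards0 addn0 card_imset // card_ord; split=> // _.
  by rewrite disjoint_sym disjoints_subset sub0set.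
have card0 : #|set0 : {set vert G}| <= theta by rewrite cards0.
have [phi [[_ phiL phiC] _]] := @list_colouring _ _ _ _ (@adj_sym G)
   (g * theta ^ 2 + t) t (isT : 1 < n.+2) (fun S x y => sparse S x y) w.+1 theta g
   (fun Y => treewidth_balanced_separation Y tw) (leq_addl _ _) (leq_addr _ _)
   (leqnn _) (leq_addr _ _) setT set0 _ lists (sub0set _) card0 adm.
exists (col \o phi); split=> [v|]; last by apply: clustered => v; apply: phiC; rewrite inE.
have /imsetP[i _ /= ->] := phiL v (in_setT v) (negbT (in_set0 v)).
exact: FL.
Qed.
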